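(* Let $n\ge 2$ and let $A$ be the $n\times n$ Hermitian matrix $$A=\begin{pmatrix} d_1&&&&a_1\\ &d_2&&&a_2\\ &&\ddots&&\vdots\\ &&&d_{n-1}&a_{n-1}\\ \bar a_1&\bar a_2&\cdots&\bar a_{n-1}&\mathbf a\end{pmatrix}$$ (unspecified entries are zero) with $d_1,\dots,d_{n-1}\in\mathbb R$ and $a_1,\dots,a_{n-1}\in\mathbb C$ fixed, and with $\mathbf a\in\mathbb R$ variable. Let $\epsilon>0$ be a fixed constant, and suppose that $$\mathbf a\ \ge\ \frac{2n-3}{\epsilon}\sum_{i=1}^{n-1}|a_i|^2+(n-1)\sum_{i=1}^{n-1}|d_i|+\frac{(n-2)\epsilon}{2n-3}.$$ Then the eigenvalues $\lambda_1,\dots,\lambda_n$ of $A$ (counted with multiplicity and suitably ordered) satisfy $$|d_\alpha-\lambda_\alpha|<\epsilon\quad\text{for all }1\le\alpha\le n-1,\qquad 0\le\lambda_n-\mathbf a<(n-1)\epsilon .$$ *)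

(* Defs.v *)
From HB Require Import structures.
From mathcomp Require Import all_boot all_order all_algebra.
From mathcomp Require Import reals complex.

Set Implicit Arguments.
Unset Strict Implicit.
Unset Printing Implicit Defensive.

Import Order.TTheory GRing.Theory Num.Theory.

Local Open Scope ring_scope.
Local Open Scope complex_scope.
Local Open Scope sesquilinear_scope.

(* The corner entry sits at index [rshift m ord0], and [d 0 i] sits on the
   diagonal at index [lshift 1 i]. *)
Definition arrow_mx (R : realType) (m : nat)
    (d : 'rV[R]_m) (a : 'cV[R[i]]_m) (b : R) : 'M[R[i]]_(m + 1) :=
  block_mx (diag_mx (map_mx (real_complex R) d)) a
           (a ^t*)                               (b%:C)%:M.

(* Main.v *)
(* The characteristic polynomial of the arrow matrix is
   [p = (X - b) D - \sum_i w_i D_i], where [w_i = |a_i|^2], [D = \prod_j (X - d_j)]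
   and [D_i = D / (X - d_i)].  A zero weight or a repeated node splits off a linear
   factor.  Otherwise [p] has a root [l] beyond the largest node [d_m], with
   [l - b = \sum_i v_i] for [v_i = w_i / (l - d_i)], and
   [p = (X - l) (D + \sum_i v_i D_i)]; the second factor is again an arrow
   polynomial, on the nodes other than [d_m], whose top root lies below [d_m].  By
   induction the remaining roots [mu_i] satisfy [mu_i <= d_i], and
   [\sum_i (d_i - mu_i) = l - b].  So all the estimates follow from [l < b + eps],
   that is from [p (b + eps) > 0], which the lower bound on [b] provides. *)
Require Import Defs.
From HB Require Import structures.
From mathcomp Require Import all_boot all_order all_algebra.
From mathcomp Require Import reals complex.
From mathcomp Require Import ring lra.

Set Implicit Arguments.
Unset Strict Implicit.
Unset Printing Implicit Defensive.

Import Order.TTheory GRing.Theory Num.Theory.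

Local Open Scope ring_scope.
Local Open Scope complex_scope.

(** * Algebraic identities for nodal and arrow polynomials *)

Definition nodal_poly (R : nzRingType) (I : finType) (d : I -> R) (B : {set I})
  : {poly R} := \prod_(j in B) ('X - (d j)%:P).

(** Taken over a subset [B] of a fixed index type, so that an induction can remove nodes without
    reindexing [d] and [w]. *)
Definition arrow_poly (R : nzRingType) (I : finType) (d : I -> R)
    (B : {set I}) (b : R) (w : I -> R) : {poly R} :=
  ('X - b%:P) * nodal_poly d B - \sum_(i in B) w i *: nodal_poly d (B :\ i).

Lemma nodal_polyD1 (R : comNzRingType) (I : finType) (d : I -> R) (B : {set I})
    (m : I) :
  m \in B -> nodal_poly d B = ('X - (d m)%:P) * nodal_poly d (B :\ m).
Proof. by move=> mB; rewrite /nodal_poly (big_setD1 m). Qed.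

(** Isolates the node [m]: a zero weight splits off ['X - d m], and at [d m] only the last term
    survives. *)
Lemma arrow_polyD1 (R : comNzRingType) (I : finType) (d : I -> R)
    (B : {set I}) (m : I) (b : R) (w : I -> R) : m \in B ->
  arrow_poly d B b w =
  ('X - (d m)%:P) * arrow_poly d (B :\ m) b w - w m *: nodal_poly d (B :\ m).
Proof.
move=> mB; rewrite /arrow_poly (nodal_polyD1 d mB) (big_setD1 m mB) /=.
under eq_bigr => i iB.
  have [im iB'] : i != m /\ i \in B by move: iB; rewrite !inE => /andP.
  rewrite (@nodal_polyD1 _ _ _ (B :\ i) m); last by rewrite !inE eq_sym im.
  have -> : B :\ i :\ m = B :\ m :\ i by apply/setP => k; rewrite !inE andbCA.
  rewrite scalerAr.
  over.
rewrite -mulr_sumr; ring.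
Qed.

(** When [d j = d m], restoring the factor of [j] in the product without [m] and [j] gives the
    product without [m], so the weight of [m] can be moved onto [j]. *)
Lemma arrow_poly_merge (R : comNzRingType) (I : finType) (d : I -> R)
    (B : {set I}) (m j : I) (b : R) (w : I -> R) :
  m \in B -> j \in B :\ m -> d j = d m ->
  arrow_poly d B b w =
  ('X - (d m)%:P) *
    arrow_poly d (B :\ m) b (fun i => w i + (if i == j then w m else 0)).
Proof.
move=> mB jB djm; rewrite (arrow_polyD1 d b w mB) /arrow_poly.
have -> : \sum_(i in B :\ m) (w i + (if i == j then w m else 0)) *:
      nodal_poly d (B :\ m :\ i) =
    \sum_(i in B :\ m) w i *: nodal_poly d (B :\ m :\ i) +
      w m *: nodal_poly d (B :\ m :\ j).
  under eq_bigr => i _ do rewrite scalerDl.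
  rewrite big_split /=; congr (_ + _).
  rewrite (big_setD1 j jB) /= eqxx big1 ?addr0 // => i.
  by rewrite !inE => /andP[/negbTE-> _]; rewrite scale0r.
by rewrite opprD addrA [RHS]mulrBr -djm -scalerAr -nodal_polyD1.
Qed.

Lemma map_nodal_poly (R S : comNzRingType) (f : {rmorphism R -> S})
    (I : finType) (d : I -> R) (B : {set I}) :
  map_poly f (nodal_poly d B) = nodal_poly (f \o d) B.
Proof.
rewrite /nodal_poly rmorph_prod; apply: eq_bigr => i _.
by rewrite rmorphB /= map_polyX map_polyC.
Qed.

Lemma map_arrow_poly (R S : comNzRingType) (f : {rmorphism R -> S})
    (I : finType) (d : I -> R) (B : {set I}) (b : R) (w : I -> R) :
  map_poly f (arrow_poly d B b w) = arrow_poly (f \o d) B (f b) (f \o w).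
Proof.
rewrite /arrow_poly rmorphB rmorphM rmorphB /= map_polyX map_polyC.
rewrite map_nodal_poly rmorph_sum; congr (_ - _); apply: eq_bigr => i _.
by rewrite -map_nodal_poly -map_polyZ.
Qed.

Lemma eq_arrow_poly (R : comNzRingType) (I : finType) (d d' : I -> R)
    (B : {set I}) (b : R) (w w' : I -> R) :
  d =1 d' -> w =1 w' -> arrow_poly d B b w = arrow_poly d' B b w'.
Proof.
move=> dd ww; have E C : nodal_poly d C = nodal_poly d' C.
  by apply: eq_bigr => j _; rewrite dd.
by rewrite /arrow_poly E; congr (_ - _); apply: eq_bigr => i _; rewrite ww E.
Qed.

(** * Values and their signs *)

Lemma horner_nodal_gt0 (R : numDomainType) (I : finType) (d : I -> R)
    (B : {set I}) (x : R) :
  {in B, forall i, d i < x} -> 0 < (nodal_poly d B).[x].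
Proof.
move=> h; rewrite horner_prod; apply: prodr_gt0 => i iB.
by rewrite !hornerE subr_gt0 h.
Qed.

(** The first factor is the secular function of the arrow matrix. *)
Lemma horner_arrow (R : fieldType) (I : finType) (d : I -> R)
    (B : {set I}) (b : R) (w : I -> R) (x : R) :
  {in B, forall i, x != d i} ->
  (arrow_poly d B b w).[x] =
  (x - b - \sum_(i in B) w i / (x - d i)) * (nodal_poly d B).[x].
Proof.
move=> h; rewrite /arrow_poly !hornerE horner_sum [RHS]mulrBl mulr_suml.
congr (_ - _); apply: eq_bigr => i iB.
rewrite hornerZ [in RHS](nodal_polyD1 d iB) !hornerE.
by rewrite /= divfK ?subr_eq0 ?h.
Qed.

Lemma horner_arrow_pole_lt0 (R : numDomainType) (I : finType) (d : I -> R)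
    (B : {set I}) (m : I) (b : R) (w : I -> R) :
  m \in B -> 0 < w m -> {in B :\ m, forall i, d i < d m} ->
  (arrow_poly d B b w).[d m] < 0.
Proof.
move=> mB wm h; rewrite (arrow_polyD1 _ _ _ mB) !hornerE subrr mul0r sub0r.
by rewrite oppr_lt0 mulr_gt0 // horner_nodal_gt0.
Qed.

(** * Division by the top root *)

(** With [v_i = w_i / (l - d_i)], the secular equation rewrites [b] as [l - \sum_i v_i]; then
    [v_i D - w_i D_i = v_i (X - l) D_i] term by term. *)
Lemma arrow_poly_factor (R : fieldType) (I : finType) (d : I -> R)
    (B : {set I}) (b : R) (w : I -> R) (l : R) :
  {in B, forall i, l != d i} ->
  l - b = \sum_(i in B) w i / (l - d i) ->
  arrow_poly d B b w = ('X - l%:P) *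
    (nodal_poly d B + \sum_(i in B) (w i / (l - d i)) *: nodal_poly d (B :\ i)).
Proof.
move=> h e; rewrite /arrow_poly mulrDr mulr_sumr.
have -> : ('X - b%:P : {poly R}) = 'X - l%:P + (\sum_(i in B) w i / (l - d i))%:P.
  by rewrite -e polyCB; ring.
rewrite mulrDl -addrA; congr (_ + _); rewrite rmorph_sum mulr_suml -sumrB.
apply: eq_bigr => i iB; rewrite (nodal_polyD1 d iB) -!mul_polyC.
have -> : w i = w i / (l - d i) * (l - d i) by field; rewrite subr_eq0 h.
rewrite polyCM polyCB mulrK ?unitfE ?subr_eq0 ?h //; ring.
Qed.

(* From [(X - d m) D_i = D - (d m - d i) D_i] for [i != m]. *)
Lemma nodal_rank1E (R : comNzRingType) (I : finType) (d : I -> R)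
    (B : {set I}) (m : I) (v : I -> R) : m \in B ->
  nodal_poly d B + \sum_(i in B) v i *: nodal_poly d (B :\ i) =
  arrow_poly d (B :\ m) (d m - \sum_(i in B) v i) (fun i => v i * (d m - d i)).
Proof.
move=> mB; rewrite /arrow_poly (nodal_polyD1 d mB) !(big_setD1 m mB) /=.
have -> : \sum_(i in B :\ m) v i *: nodal_poly d (B :\ i) =
    (\sum_(i in B :\ m) v i)%:P * nodal_poly d (B :\ m) -
    \sum_(i in B :\ m) (v i * (d m - d i)) *: nodal_poly d (B :\ m :\ i).
  rewrite rmorph_sum mulr_suml -sumrB; apply: eq_bigr => i iB.
  have [im iB'] : i != m /\ i \in B by move: iB; rewrite !inE => /andP.
  rewrite (@nodal_polyD1 _ _ _ (B :\ i) m); last by rewrite !inE eq_sym im.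
  have -> : B :\ i :\ m = B :\ m :\ i by apply/setP => k; rewrite !inE andbCA.
  by rewrite (nodal_polyD1 d iB) -!mul_polyC polyCM polyCB; ring.
by rewrite -mul_polyC !rmorphB rmorphD /=; ring.
Qed.

(** * Positivity beyond the nodes *)

Lemma horner_arrow_gt0 (R : realFieldType) (I : finType) (d : I -> R)
    (B : {set I}) (b : R) (w : I -> R) (x : R) :
  {in B, forall i, d i < x} -> \sum_(i in B) w i / (x - d i) < x - b ->
  0 < (arrow_poly d B b w).[x].
Proof.
move=> h hs; rewrite horner_arrow => [|i iB]; last by rewrite gt_eqF ?h.
by rewrite mulr_gt0 ?subr_gt0 ?horner_nodal_gt0.
Qed.

Lemma arrow_poly_pos_right (R : realFieldType) (I : finType) (d : I -> R)
    (B : {set I}) (b : R) (w : I -> R) (x0 : R) :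
  {in B, forall i, 0 <= w i} -> {in B, forall i, d i <= x0} ->
  exists2 x, x0 <= x & 0 < (arrow_poly d B b w).[x].
Proof.
move=> w0 dx; have S0 : 0 <= \sum_(i in B) w i by apply: sumr_ge0.
have hb : b <= Num.max b x0 by rewrite le_max lexx.
have hx : x0 <= Num.max b x0 by rewrite le_max lexx orbT.
(* This point is at distance at least 1 from every node, so each quotient in the secular sum is at
   most its weight. *)
exists (Num.max b x0 + 1 + \sum_(i in B) w i); first by lra.
apply: horner_arrow_gt0 => [i iB|]; first by have := dx i iB; lra.
apply: (@le_lt_trans _ _ (\sum_(i in B) w i)); last by lra.
apply: ler_sum => i iB; rewrite ler_pdivrMr; last by have := dx i iB; lra.
by rewrite ler_peMr ?w0 //; have := dx i iB; lra.
Qed.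

(** The nodal factor is positive at [x], so the linear factor carries the sign. *)
Lemma top_root_lt (R : realDomainType) (I : finType) (mu : I -> R)
    (B : {set I}) (l x : R) :
  {in B, forall i, mu i < x} -> 0 < (('X - l%:P) * nodal_poly mu B).[x] -> l < x.
Proof.
by move=> h; rewrite !hornerE pmulr_lgt0 ?subr_gt0 // horner_nodal_gt0.
Qed.

(** * Location of the roots *)

Lemma arrow_poly_roots (R : rcfType) (I : finType) (d : I -> R)
    (B : {set I}) (b : R) (w : I -> R) : {in B, forall i, 0 <= w i} ->
  exists l : R, exists mu : I -> R,
    [/\ arrow_poly d B b w = ('X - l%:P) * nodal_poly mu B,
        {in B, forall i, mu i <= d i},
        l - b = \sum_(i in B) (d i - mu i)
      & b <= l].
Proof.
(* [b] and [w] are generalized because the cofactor has a new corner and new weights. *)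
have [N] := ubnP #|B|; elim: N => // N IH in B b w * => cB w0.
have [B0|[m0 m0B]] := set_0Vmem B.
  exists b, d; rewrite B0; split=> //.
  - by rewrite /arrow_poly big_set0 subr0.
  - by rewrite big_set0 subrr.
have [m mB dm] : exists2 m, m \in B & {in B, forall i, d i <= d m}.
  by case: (arg_maxP d m0B) => m mB dm; exists m.
have cBm : (#|B :\ m| < N)%N by move: cB; rewrite (cardsD1 m) mB.
have sub i : i \in B :\ m -> i \in B by rewrite inE => /andP[].
have ne i : i \in B :\ m -> i != m by rewrite !inE => /andP[].
(* Common to a zero weight and a repeated node: [d m] stays a root and contributes a zero shift. *)
have deflate w' : {in B :\ m, forall i, 0 <= w' i} ->
    arrow_poly d B b w = ('X - (d m)%:P) * arrow_poly d (B :\ m) b w' ->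
    exists l : R, exists mu : I -> R,
    [/\ arrow_poly d B b w = ('X - l%:P) * nodal_poly mu B,
        {in B, forall i, mu i <= d i},
        l - b = \sum_(i in B) (d i - mu i)
      & b <= l].
  move=> w'0 ->; have [l [mu [-> mud lb bl]]] := IH _ b w' cBm w'0.
  exists l, (fun i => if i == m then d m else mu i); split=> //.
  - rewrite (nodal_polyD1 _ mB) eqxx mulrCA; congr (_ * (_ * _)).
    by apply: eq_bigr => i /ne/negbTE ->.
  - by move=> i iB; case: eqVneq => [->//|im]; apply: mud; rewrite !inE im.
  - rewrite lb (big_setD1 m mB) /= eqxx subrr add0r.
    by apply: eq_bigr => i /ne/negbTE ->.
have [wm|wm] := eqVneq (w m) 0.
  apply: (deflate w) => [i /sub /w0 //|].
  by rewrite (arrow_polyD1 _ _ _ mB) wm scale0r subr0.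
have {}wm : 0 < w m by rewrite lt_def wm w0.
case: (pickP [pred j | (j \in B :\ m) && (d j == d m)])
  => [j /andP[jB /eqP djm]|nd].
  apply: deflate (arrow_poly_merge b w mB jB djm) => i /sub /w0 wi.
  by case: ifP => _; rewrite ?addr0 // addr_ge0 // ltW.
have {nd}dlt i : i \in B :\ m -> d i < d m.
  move=> iB; rewrite lt_neqAle dm ?sub // andbT.
  by have := nd i; rewrite inE iB /= => ->.
have pm := horner_arrow_pole_lt0 b mB wm dlt.
have [c dc pc] := arrow_poly_pos_right b w0 dm.
have [l /andP[dl lc] lroot] : exists2 l,
    d m <= l <= c & root (arrow_poly d B b w) l.
  by apply: (poly_ivt dc); rewrite !ltW.
have {dl}dl : d m < l.
  rewrite lt_neqAle dl andbT; apply: contraTneq pm => ->.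
  by move/rootP: lroot => ->; rewrite ltxx.
have dil i : i \in B -> d i < l by move=> /dm /le_lt_trans; apply.
have lne : {in B, forall i, l != d i} by move=> i /dil /gt_eqF ->.
have lb : l - b = \sum_(i in B) w i / (l - d i).
  move/rootP: lroot; rewrite horner_arrow // => /eqP; rewrite mulf_eq0.
  by rewrite (gt_eqF (horner_nodal_gt0 dil)) orbF subr_eq0 => /eqP.
set v := fun i => w i / (l - d i) in lb.
have v0 i : i \in B -> 0 <= v i.
  by move=> iB; rewrite divr_ge0 ?w0 // subr_ge0 ltW ?dil.
have pE := arrow_poly_factor lne lb; rewrite -/v (nodal_rank1E d v mB) in pE.
have w'0 i : i \in B :\ m -> 0 <= v i * (d m - d i).
  by move=> iB; rewrite mulr_ge0 ?v0 ?subr_ge0 ?dm ?sub.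
have [l' [mu [qE mud lb' bl']]] := IH _ (d m - \sum_(i in B) v i) _ cBm w'0.
rewrite qE in pE.
(* The whole polynomial is negative at [d m] and [d m < l], so the cofactor is positive there, while
   its other roots lie below [d m]. *)
have l'd : l' < d m.
  apply: (@top_root_lt _ _ mu (B :\ m)) => [i iB|].
    exact: le_lt_trans (mud i iB) (dlt i iB).
  have: (('X - l%:P) * (('X - l'%:P) * nodal_poly mu (B :\ m))).[d m] < 0.
    by rewrite -pE.
  by rewrite hornerM nmulr_rlt0 // !hornerE subr_lt0.
exists l, (fun i => if i == m then l' else mu i); split=> //.
- rewrite pE (nodal_polyD1 _ mB) eqxx; congr (_ * (_ * _)).
  by apply: eq_bigr => i /ne/negbTE ->.
- move=> i iB; case: eqVneq => [->|im]; first exact: ltW.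
  by apply: mud; rewrite !inE im.
(* The shifts of the [mu i] add up to [l'] minus the cofactor's corner, which is [d m] minus the sum
   of the [v i]; adding [d m - l'] leaves exactly that sum. *)
- rewrite lb [RHS](big_setD1 m mB) /= eqxx.
  have -> : \sum_(i in B :\ m) (d i - (if i == m then l' else mu i)) =
      \sum_(i in B :\ m) (d i - mu i).
    by apply: eq_bigr => i /ne/negbTE ->.
  by rewrite -lb'; ring.
- by rewrite -subr_ge0 lb sumr_ge0.
Qed.

(** * Characteristic polynomial of an arrow matrix *)

Lemma char_poly_arrow (R : idomainType) (m : nat) (d : 'rV[R]_m)
    (u : 'cV[R]_m) (v : 'rV[R]_m) (s : R) :
  char_poly (block_mx (diag_mx d) u v s%:M) =
  arrow_poly (d 0) [set: 'I_m] s (fun i => v 0 i * u i 0).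
Proof.
set D := nodal_poly (d 0) [set: 'I_m].
pose Di (i : 'I_m) := nodal_poly (d 0) ([set: 'I_m] :\ i).
have DE i : D = ('X - (d 0 i)%:P) * Di i by rewrite /D (@nodal_polyD1 _ _ _ _ i).
have D0 : D != 0.
  by apply/prodf_neq0 => i _; rewrite polyXsubC_eq0.
pose Dg : 'M[{poly R}]_m := diag_mx (\row_i ('X - (d 0 i)%:P)).
have detDg : \det Dg = D.
  rewrite det_diag /D /nodal_poly; under eq_bigr do rewrite mxE.
  by apply: eq_bigl => i; rewrite inE.
have cE : char_poly_mx (block_mx (diag_mx d) u v s%:M) =
    block_mx Dg (- map_mx polyC u) (- map_mx polyC v) ('X - s%:P)%:M.
  rewrite /char_poly_mx map_block_mx (@scalar_mx_block _ m 1) opp_block_mx.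
  rewrite add_block_mx !add0r; congr block_mx.
    apply/matrixP => i j; rewrite !mxE; case: eqP => _; rewrite ?mulr1n ?mulr0n //.
    by rewrite subrr.
  by rewrite map_scalar_mx -raddfB.
(* Right multiplication by [block_mx 1 y 0 D] clears the upper right block; the
   extra factor [D] of the determinant is then cancelled. *)
pose y : 'cV[{poly R}]_m := \col_i (Di i * (u i 0)%:P).
have /(congr1 determinant) : char_poly_mx (block_mx (diag_mx d) u v s%:M) *m
    block_mx 1%:M y 0 D%:M =
    block_mx Dg 0 (- map_mx polyC v)
      (arrow_poly (d 0) [set: 'I_m] s (fun i => v 0 i * u i 0))%:M.
  rewrite cE mulmx_block !mulmx1 !mulmx0 !addr0; congr block_mx.
    apply/matrixP => i j; rewrite mul_diag_mx mul_mx_scalar !mxE (DE i).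
    by rewrite (ord1 j); ring.
  apply/matrixP => i j; rewrite !ord1 -scalar_mxM !mxE eqxx !mulr1n.
  rewrite /arrow_poly -/D addrC; congr (_ + _).
  rewrite -sumrN; apply: eq_big => [k|k _]; first by rewrite inE.
  by rewrite !mxE -/(Di k) -mul_polyC polyCM; ring.
rewrite det_mulmx det_ublock det_lblock det1 mul1r !det_scalar1 detDg mulrC.
by move/(mulfI D0).
Qed.

(** * Eigenvalue estimates *)

Theorem lemma3p1 (R : realType) (n : nat) (hn : (2 <= n)%N)
    (d : 'rV[R]_n.-1) (a : 'cV[R[i]]_n.-1) (eps : R) (heps : 0 < eps)
    (b : R)
    (hb : (2 * n%:R - 3) / eps * (\sum_i Normc.normc (a i 0) ^+ 2)
          + (n%:R - 1) * (\sum_i `|d 0 i|)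
          + (n%:R - 2) * eps / (2 * n%:R - 3) <= b) :
  exists lam : 'I_(n.-1 + 1) -> R,
    [/\ char_poly (arrow_mx d a b) = \prod_i ('X - ((lam i)%:C)%:P),
        forall i : 'I_n.-1, `|d 0 i - lam (lshift 1 i)| < eps
      & 0 <= lam (rshift n.-1 ord0) - b < (n%:R - 1) * eps].
Proof.
pose w i := Normc.normc (a i 0) ^+ 2; pose S := \sum_i w i.
have w0 i : 0 <= w i by exact: sqr_ge0.
have S0 : 0 <= S by exact: sumr_ge0.
have n2 : (2 : R) <= n%:R by rewrite ler_nat.
(* Since [2 <= n], the factors [2n - 3] and [n - 1] are at least 1 and the last term of the lower
   bound is nonnegative. *)
have bd i : d 0 i + S / eps <= b.
  have di : d 0 i <= \sum_j `|d 0 j|.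
    rewrite (le_trans (ler_norm _)) // (bigD1 i) //= lerDl; exact: sumr_ge0.
  have d0 : 0 <= \sum_j `|d 0 j| by exact: sumr_ge0.
  have h1 : S / eps <= (2 * n%:R - 3) / eps * S.
    rewrite mulrAC -mulrA ler_peMl ?divr_ge0 //; [exact: ltW|lra].
  have h2 : \sum_j `|d 0 j| <= (n%:R - 1) * \sum_j `|d 0 j|.
    by rewrite ler_peMl //; lra.
  have h3 : 0 <= (n%:R - 2) * eps / (2 * n%:R - 3).
    by rewrite divr_ge0 ?mulr_ge0 ?(ltW heps) //; lra.
  by rewrite -/S in hb; lra.
have [l [mu [pE mud lb bl]]] := @arrow_poly_roots R _ (d 0) [set: 'I_n.-1] b w
  (fun i _ => w0 i).
have Se : 0 <= S / eps by rewrite divr_ge0 // ltW.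
have leps : l < b + eps.
  apply: (@top_root_lt _ _ mu [set: 'I_n.-1]) => [i iT|].
    by have := mud i iT; have := bd i; lra.
  rewrite -pE; apply: horner_arrow_gt0 => [i iT|]; first by have := bd i; lra.
  have pos : 0 < S / eps + eps by lra.
  (* Every node is at distance at least [S / eps + eps] from [b + eps]; the quotient is below [eps]
     because [S < S + eps ^+ 2]. *)
  apply: (@le_lt_trans _ _ (S / (S / eps + eps))).
    rewrite (_ : S = \sum_(i in [set: 'I_n.-1]) w i); last first.
      by apply: eq_bigl => i; rewrite inE.
    rewrite mulr_suml; apply: ler_sum => i iT; rewrite ler_wpM2l //.
    have -> : \sum_(i in [set: 'I_n.-1]) w i = S.
      by apply: eq_bigl => j; rewrite inE.
    by rewrite lef_pV2 ?posrE //; have := bd i; lra.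
  rewrite ltr_pdivrMr // [b + eps]addrC addrK mulrDr mulrCA divff ?gt_eqF //.
  by rewrite mulr1 ltrDl mulr_gt0.
(* The shifts are nonnegative with sum [l - b], so none exceeds it. *)
have dmu i : d 0 i - mu i <= l - b.
  rewrite lb (big_setD1 i) ?inE //= lerDl; apply: sumr_ge0 => j _.
  by rewrite subr_ge0 mud ?inE.
exists (fun k => match split k with inl i => mu i | inr _ => l end); split.
- rewrite /arrow_mx char_poly_arrow big_split_ord big_ord1 /=.
  rewrite (unsplitK (inr ord0 : 'I_n.-1 + 'I_1)) mulrC.
  have -> : \prod_i ('X - ((match split (lshift 1 i) with
                          | inl i => mu i | inr _ => l end)%:C)%:P) =
      nodal_poly (real_complex R \o mu) [set: 'I_n.-1].
    apply: eq_big => [i|i _]; first by rewrite inE.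
    by rewrite (unsplitK (inl i : 'I_n.-1 + 'I_1)).
  have -> : 'X - (l%:C)%:P = map_poly (real_complex R) ('X - l%:P).
    by rewrite rmorphB /= map_polyX map_polyC.
  (* The factorization holds over [R] and is carried to [R[i]]; the weights agree since the
     conjugate of [a_i] times [a_i] is the squared modulus. *)
  rewrite -map_nodal_poly -rmorphM -pE.
  apply: etrans (esym (map_arrow_poly _ _ _ _ _)).
  apply: eq_arrow_poly => i; rewrite /= !mxE // mulrC -normCK.
  by rewrite /w rmorphXn.
- move=> i; rewrite (unsplitK (inl i : 'I_n.-1 + 'I_1)) ger0_norm; last first.
    by rewrite subr_ge0 mud ?inE.
  by have := dmu i; lra.
- rewrite (unsplitK (inr ord0 : 'I_n.-1 + 'I_1)) /=; apply/andP; split; first by lra.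
  have : eps <= (n%:R - 1) * eps by rewrite ler_peMl ?(ltW heps) //; lra.
  by lra.
Qed.
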